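(* Every finite abelian group other than $\mathbb{Z}_2$ is doubly R-sequenceable.
   Context: For a subset $A$ of a finite group $G$, $\mathcal{P}_k(A)$ denotes the set of finite sequences of elements of $A$ containing every element of $A$ exactly $k$ times. For a sequence $g_1,\dots,g_m$ set $g_0=g_m$ and $\bar g_i=g_{i-1}^{-1}g_i$ ($1\le i\le m$); $\check{\mathbf g}$ denotes the sequence $\bar g_1,\dots,\bar g_m$ (cyclic consecutive quotients). $G$ is doubly R-sequenceable if there is $\mathbf g\in\mathcal P_2(G\setminus\{1_G\})$ with $\check{\mathbf g}\in\mathcal P_2(G\setminus\{1_G\})$. *)

(* Defs.v *)
From mathcomp Require Import all_boot all_fingroup.
Set Implicit Arguments.
Unset Strict Implicit.
Unset Printing Implicit Defensive.

Local Open Scope group_scope.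

(* P_k(A) *)
Definition seqs_exactly (T : finType) (k : nat) (A : {set T}) : {pred seq T} :=
  [pred s | all [in A] s && [forall x in A, count_mem x s == k]].

(* The quotients g_{i-1}^-1 * g_i for 1 <= i <= m, where g_0 = g_m is supplied
   as the accumulator of pairmap. The default 1 is only reached when s is
   empty, and then the result is empty too. *)
Definition cyclic_quotients (gT : finGroupType) (s : seq gT) : seq gT :=
  pairmap (fun x y => x^-1 * y) (last 1 s) s.

Definition doubly_R_sequenceable (gT : finGroupType) (G : {group gT}) : Prop :=
  exists2 s : seq gT,
    s \in seqs_exactly 2 G^# & cyclic_quotients s \in seqs_exactly 2 G^#.

(* Main.v *)
(** The cyclic sequences [s] such that [s] and its quotients both cover [G^#]
    exactly twice are the Eulerian circuits of the connected graphs on [G^#]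
    with in- and out-degree 2 in which each difference occurs on two arcs.

    One proves more: if [#|G| > 2], the circuit can be chosen to contain
    [a, a + b, b] for some [a, b] (Friedlander, Gordon and Miller's R*
    condition).  This is done by induction along an extension [N -> A -> Q]
    with [N] of odd prime order or of order 4.  The arc [q -> q'] of step [i]
    of a circuit of [Q] is lifted to the reflection [u |-> k i - u] from the
    fibre of [q] to that of [q'].  Its differences [k i - 2u] cover a coset of
    [N] if [#|N|] is odd, and half a coset twice if [N] is cyclic of order 4,
    where the two arcs of [Q] with the same difference take complementary
    halves.  Going once around the circuit of [Q] is a translation by some
    [g] in [N], which may be taken nonzero.  The circuit [n0, ..., n1] of [N]
    is inserted at an R* triple of [Q]: for suitable lifts [z -> w] and
    [x -> y] of its two arcs, deleting them along with [n1 -> n0] and adding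
    [z -> n0], [n1 -> y] and [x -> w] preserves all differences.  The R*
    triple of the result is that of [N].

    The induction starts from finite fields, where one uses the arcs
    [x -> g x] and [x -> (1 - 1/g) x] for a generator [g] of the unit group;
    from [Z_2 * F_p]; and from [Z_4], [Z_8] and [Z_4 * Z_2]. *)

From HB Require Import structures.
Require Import Defs.
From mathcomp Require Import all_boot all_fingroup all_algebra all_solvable all_field.
From mathcomp Require Import zify ring.
Set Implicit Arguments.
Unset Strict Implicit.
Unset Printing Implicit Defensive.
Import GRing.Theory.

(** * Eulerian circuits *)

Section Euler.
Variable T : eqType.
Implicit Types (x v : T) (s : seq T) (E R : seq (T * T)).

Lemma unzip1_pairmap x s : unzip1 (pairmap pair x s) = belast x s.
Proof. by elim: s x => //= y s IHs x; rewrite IHs. Qed.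

Lemma unzip2_pairmap x s : unzip2 (pairmap pair x s) = s.
Proof. by elim: s x => //= y s IHs x; rewrite IHs. Qed.

Lemma count_belast v x s :
  count_mem v (belast x s) + (last x s == v) = (x == v) + count_mem v s.
Proof. by elim: s x => //= [x|y s IHs x]; rewrite ?addn0 // -addnA IHs. Qed.

Lemma balanced_trail x s R :
    last x s = x -> perm_eq (unzip1 (pairmap pair x s ++ R))
                            (unzip2 (pairmap pair x s ++ R)) ->
  perm_eq (unzip1 R) (unzip2 R).
Proof.
move=> sx /seq.permP bal; apply/allP => v _ /=; apply/eqP.
have := bal (pred1 v); rewrite /unzip1 /unzip2 !map_cat !count_cat.
rewrite [map fst _]unzip1_pairmap [map snd _]unzip2_pairmap.
by have := count_belast v x s; rewrite sx /=; lia.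
Qed.

Lemma balanced_perm E E' : perm_eq E E' ->
  perm_eq (unzip1 E) (unzip2 E) -> perm_eq (unzip1 E') (unzip2 E').
Proof.
move=> EE' bal; rewrite -(permPl (perm_map fst EE')).
by rewrite -(permPr (perm_map snd EE')).
Qed.

Lemma trail_extend x s R : s != [::] ->
    perm_eq (unzip1 (pairmap pair x s ++ R)) (unzip2 (pairmap pair x s ++ R)) ->
  exists c R', [/\ c != [::], last x c = x &
    perm_eq (pairmap pair x s ++ R) (pairmap pair x c ++ R')].
Proof.
have [n] := ubnP (size R); elim: n s R => // n IHn s R ltRn s0 bal.
have [sx | sx] := eqVneq (last x s) x; first by exists s, R.
have /mapP[[u w] uwR /= uE]: last x s \in unzip1 R.
  rewrite -has_pred1 has_count.
  move/seq.permP/(_ (pred1 (last x s))): bal.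
  rewrite /unzip1 /unzip2 !map_cat !count_cat.
  rewrite [map fst _]unzip1_pairmap [map snd _]unzip2_pairmap.
  have := count_belast (last x s) x s.
  by rewrite eqxx [x == _]eq_sym (negPf sx) /=; lia.
have permR := perm_to_rem uwR.
have permE: perm_eq (pairmap pair x s ++ R)
                    (pairmap pair x (rcons s w) ++ rem (u, w) R).
  by rewrite -cats1 pairmap_cat -catA /= uE perm_cat2l.
have [|||c [R' [c0 cx permc]]] := IHn (rcons s w) (rem (u, w) R).
- by rewrite -ltnS (leq_trans _ ltRn) // ltnS (perm_size permR).
- by case: (s).
- exact: balanced_perm bal.
by exists c, R'; split=> //; apply: perm_trans permc.
Qed.

Lemma closed_trail E v : perm_eq (unzip1 E) (unzip2 E) -> v \in unzip1 E ->
  exists c R, [/\ c != [::], last v c = v & perm_eq E (pairmap pair v c ++ R)].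
Proof.
move=> bal /mapP[[u w] uwE /= ->]; have permE := perm_to_rem uwE.
have [||c [R [c0 cu permc]]] := @trail_extend u [:: w] (rem (u, w) E) => //.
  exact: balanced_perm bal.
by exists c, R; split=> //; apply: perm_trans permc.
Qed.

Lemma eulerian_circuit E : E != [::] -> perm_eq (unzip1 E) (unzip2 E) ->
    (forall P : pred T, {in E, forall e, P e.1 = P e.2} ->
      {in unzip1 E &, forall v w, P v = P w}) ->
  exists x s, last x s = x /\ perm_eq (pairmap pair x s) E.
Proof.
move=> E0 bal conn.
have [v vE]: exists v, v \in unzip1 E.
  by case: (E) E0 => // e E' _; exists e.1; rewrite mem_head.
have [s [R [s0 sx permE]]] := closed_trail bal vE.
have [n] := ubnP (size R); elim: n v vE s R s0 sx permE => // n IHn x xE s R s0 sx permE ltRn.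
have balR: perm_eq (unzip1 R) (unzip2 R).
  exact: balanced_trail sx (balanced_perm permE bal).
have xs: x \in s by rewrite -{1}sx; case: (s) s0 => //= y s' _; apply: mem_last.
have [R0 | R0] := eqVneq R [::].
  by exists x, s; split=> //; rewrite perm_sym; move: permE; rewrite R0 cats0.
have /hasP[v vs vR]: has [in unzip1 R] s.
  apply/negPn/negP => /hasPn noR.
  have R1s: {in R, forall e, e.1 \in s = false}.
    by move=> e eR; apply/negP => /noR /=; rewrite map_f.
  have Pconst: {in E, forall e, (e.1 \in s) = (e.2 \in s)}.
    move=> e; rewrite (perm_mem permE) mem_cat => /orP[eP | eR].
      have e1: e.1 \in belast x s by rewrite -unzip1_pairmap map_f.
      have e2: e.2 \in s by rewrite -(unzip2_pairmap x s) map_f.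
      by rewrite e2; move/mem_belast: e1; rewrite inE => /predU1P[->|].
    rewrite R1s //; apply/esym/negP => e2s.
    by have /noR := e2s; rewrite /= (perm_mem balR) map_f.
  have [e eR]: exists e, e \in R by case: (R) R0 => // e R' _; exists e; rewrite mem_head.
  have eE: e \in E by rewrite (perm_mem permE) mem_cat eR orbT.
  by have := conn [in s] Pconst x e.1 xE (map_f _ eE); rewrite /= xs R1s.
have [c [R' [c0 cv permR]]] := closed_trail balR vR.
case/splitPr: vs sx permE => s1 s2 sx permE.
apply: (IHn x xE (s1 ++ v :: c ++ s2) R').
- by case: (s1).
- by move: sx; rewrite !last_cat /= last_cat cv.
- apply: (perm_trans permE); rewrite !pairmap_cat /= pairmap_cat cv.
  rewrite -!catA perm_cat2l /= perm_cons -catA.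
  by rewrite perm_sym perm_catCA perm_cat2l perm_sym.
rewrite -ltnS (leq_trans _ ltRn) // ltnS (perm_size permR) size_cat size_pairmap.
by case: (c) c0 => //= y c' _; lia.
Qed.

End Euler.

Section Bypass.
Variable T : eqType.
Implicit Types (x v : T) (s : seq T) (E : seq (T * T)).

Lemma mem_pairmap_pair x s e : e \in pairmap pair x s ->
  exists s1 s2, s = s1 ++ e.2 :: s2 /\ last x s1 = e.1.
Proof.
elim: s x => //= y s IHs x; rewrite inE => /predU1P[-> | /IHs[s1 [s2 [-> s1e]]]].
  by exists [::], s.
by exists (y :: s1), s2.
Qed.

(** The arc from [a] to [b] is virtual: an Eulerian circuit is cut at it, and the resulting trail
    can later be closed by any other path from [a] to [b]. *)
Lemma eulerian_bypass E a b :
    perm_eq (unzip1 ((a, b) :: E)) (unzip2 ((a, b) :: E)) ->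
    (forall P : pred T, {in (a, b) :: E, forall e, P e.1 = P e.2} ->
      {in unzip1 ((a, b) :: E) &, forall v w, P v = P w}) ->
  exists s, last b s = a /\ perm_eq (pairmap pair b s) E.
Proof.
move=> bal conn; have [//|x [s [sx permE]]] := eulerian_circuit _ bal conn.
have: (a, b) \in pairmap pair x s by rewrite (perm_mem permE) mem_head.
case/mem_pairmap_pair=> s1 [s2 /= [sE s1a]].
rewrite sE last_cat /= in sx; exists (s2 ++ s1).
split; first by rewrite last_cat sx.
rewrite -(perm_cons (a, b)) -(permPr permE) sE !pairmap_cat sx /= s1a.
by rewrite -cat_cons perm_catC.
Qed.

End Bypass.

(** * Linear identities in Z-modules *)

(** Syntax of expressions in an abelian group; identities are decided by comparing the integer
    coefficients of each atom. *)
Inductive zexp :=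
  ZVar of nat | ZZero | ZAdd of zexp & zexp | ZOpp of zexp | ZMul of zexp & nat.

Fixpoint zeval (V : zmodType) (env : seq V) (e : zexp) : V :=
  match e with
  | ZVar i => env`_i
  | ZZero => 0
  | ZAdd e1 e2 => zeval env e1 + zeval env e2
  | ZOpp e1 => - zeval env e1
  | ZMul e1 n => zeval env e1 *+ n
  end%R.

Fixpoint zcoef (e : zexp) (i : nat) : int :=
  match e with
  | ZVar j => (i == j)%:R
  | ZZero => 0
  | ZAdd e1 e2 => zcoef e1 i + zcoef e2 i
  | ZOpp e1 => - zcoef e1 i
  | ZMul e1 n => zcoef e1 i *+ n
  end%R.

Lemma zevalE (V : zmodType) (env : seq V) e :
  zeval env e = (\sum_(i < size env) env`_i *~ zcoef e i)%R.
Proof.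
elim: e => [j||e1 IH1 e2 IH2|e1 IH1|e1 IH1 n] /=.
- have [ltj | lej] := ltnP j (size env).
    rewrite (bigD1 (Ordinal ltj)) //= eqxx big1 ?addr0 // => i ij.
    by rewrite [_ == _](negPf ij) mulr0z.
  rewrite nth_default // big1 // => i _.
  by rewrite ltn_eqF ?mulr0z // (leq_trans _ lej).
- by rewrite big1 // => i _; rewrite mulr0z.
- by rewrite IH1 IH2 -big_split; apply: eq_bigr => i _ /=; rewrite mulrzDr.
- by rewrite IH1 -sumrN; apply: eq_bigr => i _; rewrite mulrNz.
- rewrite IH1 -sumrMnl; apply: eq_bigr => i _ /=.
  by rewrite -[in RHS]mulr_natr mulrzA mulrz_nat.
Qed.

Lemma zexp_eq (V : zmodType) (env : seq V) e1 e2 :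
    all (fun i => zcoef e1 i == zcoef e2 i) (iota 0 (size env)) ->
  zeval env e1 = zeval env e2.
Proof.
move=> /allP eq12; rewrite !zevalE; apply: eq_bigr => i _.
by rewrite (eqP (eq12 i _)) // mem_iota ltn_ord.
Qed.

(** Atoms are identified up to unification. The inner [match goal] runs [unify] while the term is
    being built, and its failure passes to the next branch. *)
Ltac zmem x env :=
  match env with
  | nil => constr:(false)
  | ?y :: _ => let _ := match goal with _ => unify x y end in constr:(true)
  | _ :: ?env' => zmem x env'
  end.
Ltac zindex x env :=
  match env with
  | ?y :: _ => let _ := match goal with _ => unify x y end in constr:(O)
  | _ :: ?env' => let i := zindex x env' in constr:(S i)
  end.
Ltac zvars e env :=
  lazymatch e with
  | (?e1 + ?e2)%R => let env1 := zvars e1 env in zvars e2 env1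
  | (- ?e1)%R => zvars e1 env
  | (?e1 *+ S ?n)%R => zvars e1 env
  | 0%R => env
  | ?x => lazymatch zmem x env with true => env | false => constr:(x :: env) end
  end.
Ltac zreify e env :=
  lazymatch e with
  | (?e1 + ?e2)%R =>
    let r1 := zreify e1 env in let r2 := zreify e2 env in constr:(ZAdd r1 r2)
  | (- ?e1)%R => let r1 := zreify e1 env in constr:(ZOpp r1)
  | (?e1 *+ S ?n)%R => let r1 := zreify e1 env in constr:(ZMul r1 (S n))
  | 0%R => constr:(ZZero)
  | ?x => let i := zindex x env in constr:(ZVar i)
  end.
Ltac zmodule :=
  lazymatch goal with
  | |- @eq ?V ?e1 ?e2 =>
    let env0 := zvars e1 (@nil V) in let env := zvars e2 env0 in
    let r1 := zreify e1 env in let r2 := zreify e2 env in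
    apply: (@zexp_eq _ env r1 r2); vm_compute; reflexivity
  end.


(** * Lifting a circuit along an extension *)

Local Open Scope ring_scope.

Section FirstOccurrence.
Variables (T : eqType) (d : nat -> T) (q : T).

Lemma mem_map_iota n :
  (q \in map d (iota 0 n)) = (0 < \sum_(i < n) (d i == q))%N.
Proof.
elim: n => [|n IHn]; first by rewrite big_ord0.
rewrite -addn1 iotaD map_cat mem_cat IHn addn1 big_ord_recr /= inE add0n.
by rewrite addn_gt0 lt0b eq_sym.
Qed.

(** Tells apart the two arcs of the circuit of [Q] with a given difference: exactly one of them
    comes first. *)
Lemma sum_first_occurrence n :
  (\sum_(i < n) ((d i == q) && (d i \notin map d (iota 0 i)))
   = (0 < \sum_(i < n) (d i == q)))%N.
Proof.
elim: n => [|n IHn]; first by rewrite !big_ord0.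
rewrite !big_ord_recr /= IHn; have [-> | _] /= := eqVneq (d n) q.
  by rewrite mem_map_iota; case: (\sum_(i < n) _)%N.
by rewrite !addn0.
Qed.

End FirstOccurrence.

(** * Choice of the reflections that lift the arcs of the circuit *)

Section Multipliers.
Variables (A Q : finZmodType) (pi : {additive A -> Q}).

Fixpoint walk (k : nat -> A) (i : nat) (u : A) : A :=
  if i is j.+1 then k j - walk k j u else u.

Lemma walkE k i u : walk k i u = walk k i 0 + (if odd i then - u else u).
Proof.
elim: i => [|i IHi] /=; first by rewrite add0r.
by rewrite IHi; case: (odd i) => /=; zmodule.
Qed.

Lemma walk_shift k e i : (1 < i)%N ->
  walk (fun j => k j + (if j == 1%N then e else 0)) i 0
  = walk k i 0 + (if odd i then - e else e).
Proof.
elim: i => // i IHi; case: (ltngtP i 1%N) => [|lti _|-> _].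
- by case: i {IHi}.
- rewrite /= IHi // gtn_eqF //; case: (odd i) => /=; zmodule.
- rewrite /=; zmodule.
Qed.

Variables (rep : Q -> A) (L : nat) (sg : nat -> Q) (t h n0 n1 : A).
Hypothesis repK : forall q, pi (rep q) = q.
Hypothesis sg_count : forall q, (\sum_(i < L) (sg i == q) = (q != 0%R).*2)%N.
Hypothesis dsg_count :
  forall q, (\sum_(i < L) ((sg i.+1 - sg i)%R == q) = (q != 0%R).*2)%N.
Hypotheses (sgL : sg L = sg 0%N) (L_gt3 : (3 < L)%N) (L_even : ~~ odd L).
(** This is the R* triple of [Q], placed across the closing point of the circuit. *)
Hypothesis sg0 : sg 0%N = sg 1%N + sg L.-1.
Hypotheses (pit : pi t = 0) (pih : pi h = 0) (h2 : h *+ 2 != 0).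
Hypotheses (pin0 : pi n0 = 0) (pin1 : pi n1 = 0).
(** Treats both kinds of kernel at once. In odd order, [t = 0] and doubling is bijective; in [Z_4],
    [t = 1] and exactly one of [y] and [y + t] is a double, in two ways. *)
Hypothesis t_count : forall y, pi y = 0 ->
  (\sum_(m : A) ((pi m == 0%R) && (m *+ 2 == y)%R) +
   \sum_(m : A) ((pi m == 0%R) && (m *+ 2 == y + t)%R) = 2)%N.

Lemma sg_neq0 i : (i < L)%N -> sg i != 0.
Proof.
move=> ltiL; have := sg_count (sg i).
by rewrite (bigD1 (Ordinal ltiL)) //= eqxx; case: (sg i != 0).
Qed.

(** With [z = rep (sg L.-1)], [w = k L.-1 - z], [x = w + n1 - n0] and [y = k 0 - x], the equation
    for [k 0] amounts to [y - n1 = w - z] and yields [n0 - z = y - x]. This is why the later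
    exchange of arcs preserves differences. *)
Lemma exists_multipliers : exists k : nat -> A,
  [/\ forall i, pi (k i) = sg i + sg i.+1,
      forall g, (\sum_(i < L) \sum_(u : A)
        ((pi u == sg i) && (k i - u *+ 2 == g)%R) = (pi g != 0%R).*2)%N,
      k 0%N = n1 *+ 2 + k L.-1 *+ 2 - n0 - rep (sg L.-1) *+ 3 &
      walk k L 0 != 0].
Proof.
pose d i := sg i.+1 - sg i.
pose eps i := d i \in map d (iota 0 i).
pose kL := rep (d L.-1) + rep (sg L.-1) *+ 2 + t *+ eps L.-1.
(* [B] picks a base point in the coset over each difference. Over [d 0] it is solved from the
   equation for [k 0]; since [d 0] and [d L.-1] differ, [k L.-1] keeps the value [kL]. *)
pose B q := if q == d 0%N then
  n1 *+ 2 + kL *+ 2 - n0 - rep (sg L.-1) *+ 3 - rep (sg 0%N) *+ 2 else rep q.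
(* The second occurrence of a difference is shifted by [t]. The adjustable term [e] sits at step 1,
   away from the constrained steps 0 and [L.-1]. *)
pose K e i := B (d i) + rep (sg i) *+ 2 + t *+ eps i + (if i == 1%N then e else 0).
have d0 : d 0%N = - sg L.-1 by rewrite /d sg0; zmodule.
have dL : d L.-1 = sg 1%N by rewrite /d prednK ?sgL ?sg0; [zmodule | lia].
have piB q : pi (B q) = q.
  rewrite /B; case: eqP => [-> | _]; rewrite ?repK //.
  by rewrite !(raddfMn, raddfB, raddfN, raddfD) /=
    !repK pit pin0 pin1 !mul0rn dL d0 sg0; zmodule.
have K0 e : K e 0%N = n1 *+ 2 + K e L.-1 *+ 2 - n0 - rep (sg L.-1) *+ 3.
  have -> : K e L.-1 = kL.
    rewrite /K /B gtn_eqF ?addr0; last by lia.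
    suff /negPf-> : d L.-1 != d 0%N by [].
    by rewrite d0 dL -addr_eq0 -sg0 sg_neq0 //; lia.
  by rewrite /K /B eqxx /eps /= mulr0n; zmodule.
have piK e i : pi e = 0 -> pi (K e i) = sg i + sg i.+1.
  move=> pie; have pi_if : pi (if i == 1%N then e else 0) = 0.
    by case: ifP; rewrite ?raddf0.
  by rewrite /K !(raddfMn, raddfD) /= pi_if piB repK pit mul0rn /d; zmodule.
have countK e0 g : pi e0 = 0 -> (\sum_(i < L) \sum_(u : A)
    ((pi u == sg i) && (K (e0 *+ 2) i - u *+ 2 == g)%R) = (pi g != 0%R).*2)%N.
  move=> pie0; pose y := B (pi g) - g.
  have pie2 : pi (e0 *+ 2) = 0 by rewrite raddfMn pie0 mul0rn.
  have piy : pi y = 0 by rewrite raddfB piB subrr.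
  pose c (b : bool) := (\sum_(m : A) ((pi m == 0%R) && (m *+ 2 == y + t *+ b)%R))%N.
  have c01 : (c false + c true = 2)%N by rewrite /c /= addr0 t_count.
  have inner (i : 'I_L) : (\sum_(u : A)
      ((pi u == sg i) && (K (e0 *+ 2)%R i - u *+ 2 == g)%R)
      = ((d i == pi g) && ~~ eps i) * c false
        + ((d i == pi g) && eps i) * c true)%N.
    have [dig | dig] /= := eqVneq (d i) (pi g); last first.
      rewrite big1 // => u _; apply/eqP; rewrite eqb0; apply/negP.
      case/andP=> /eqP piu /eqP gE; case/eqP: dig.
      by rewrite -gE raddfB piK // raddfMn /= piu /d; zmodule.
    (* Recentring the fibre, and at step 1 absorbing the shift by [e0 *+ 2], leaves a count of the
       [m] in the kernel whose double is [y], or [y + t] at a second occurrence. *)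
    rewrite (reindex_inj (addrI (rep (sg i) + (if i == 1%N :> nat then e0 else 0)))) /=.
    transitivity (c (eps i)); last by case: (eps i) => /=; lia.
    apply: eq_bigr => m _; congr (nat_of_bool (_ && _)).
      have pi_if : pi (if i == 1%N :> nat then e0 else 0) = 0.
        by case: ifP; rewrite ?raddf0.
      rewrite !raddfD /= repK pi_if addr0.
      by rewrite -{2}[sg i]addr0 (inj_eq (addrI _)).
    rewrite -[LHS](inj_eq (addIr (m *+ 2 - g))) eq_sym; congr (_ == _).
      by zmodule.
    by rewrite /K /y -dig; case: ifP => _; zmodule.
  rewrite (eq_bigr _ (fun i _ => inner i)) big_split /= -!big_distrl /=.
  have first1 := sum_first_occurrence d (pi g) L.
  have dcount := dsg_count (pi g).
  have split_d : (\sum_(i < L) (d i == pi g) =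
      \sum_(i < L) ((d i == pi g) && ~~ eps i) +
      \sum_(i < L) ((d i == pi g) && eps i))%N.
    by rewrite -big_split; apply: eq_bigr => i _ /=; case: (_ == _); case: (eps i).
  rewrite -/(d _) in dcount.
  move: first1 split_d; rewrite dcount /eps => ->.
  by case: (pi g != 0) => /= split_d; nia.
(* If the walk closes up, shifting step 1 by [h *+ 2] moves its end by this nonzero element; being a
   double, the shift does not affect the counts. *)
have [w0 | w0] := eqVneq (walk (K 0) L 0) 0; last first.
  exists (K 0); split=> // [i | g]; first by rewrite piK ?raddf0.
  by have := countK 0 g (raddf0 _); rewrite mul0rn.
exists (K (h *+ 2)); split=> // [i | g|]; first by rewrite piK // raddfMn pih mul0rn.
  exact: countK.
have -> : walk (K (h *+ 2)) L 0 =
   walk (fun j => K 0 j + (if j == 1%N then h *+ 2 else 0)) L 0.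
  by elim: (L) => //= i ->; rewrite /K; case: eqP; rewrite ?addr0.
by rewrite walk_shift ?w0 ?(negPf L_even) ?add0r //; lia.
Qed.

End Multipliers.

Definition doubly_covers (V : zmodType) (l : seq V) :=
  forall v, count_mem v l = (v != 0).*2.

Definition differences (V : zmodType) (E : seq (V * V)) : seq V :=
  [seq e.2 - e.1 | e <- E].

Definition cyclic_arcs (V : zmodType) (s : seq V) : seq (V * V) :=
  pairmap pair (last 0 s) s.

(** As the sequence is read cyclically, the R* triple can be put at its front. *)
Definition doubly_Rstar (V : zmodType) (s : seq V) : Prop :=
  [/\ doubly_covers s, doubly_covers (differences (cyclic_arcs s)) &
      exists a b r, s = [:: a, a + b, b & r]].

(** * Exchange of arcs, and connectivity of the lifted graph *)

Section Lift.
Variables (A Q : finZmodType) (pi : {additive A -> Q}).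
Variables (rep : Q -> A) (L : nat) (sg : nat -> Q) (t h n0 n1 : A).
Hypothesis repK : forall q, pi (rep q) = q.
Hypothesis sg_count : forall q, (\sum_(i < L) (sg i == q) = (q != 0%R).*2)%N.
Hypothesis dsg_count :
  forall q, (\sum_(i < L) ((sg i.+1 - sg i)%R == q) = (q != 0%R).*2)%N.
Hypotheses (sgL : sg L = sg 0) (L_gt3 : (3 < L)%N) (L_even : ~~ odd L).
Hypothesis sg0 : sg 0 = sg 1 + sg L.-1.
Hypotheses (pit : pi t = 0) (pih : pi h = 0) (h2 : h *+ 2 != 0).
Hypotheses (pin0 : pi n0 = 0) (pin1 : pi n1 = 0).
Hypothesis t_count : forall y, pi y = 0 ->
  (\sum_(m : A) ((pi m == 0%R) && (m *+ 2 == y)%R) +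
   \sum_(m : A) ((pi m == 0%R) && (m *+ 2 == y + t)%R) = 2)%N.
(** Translation by [g] comes from going once around the circuit, and the relation between [n0 - n1]
    and [0] from the new arc [x -> w], as [w = x + (n0 - n1)]. *)
Hypothesis ker_connected : forall g, pi g = 0 -> g != 0 -> forall F : pred A,
  (forall m, pi m = 0 -> F (m + g) = F m) -> F (n0 - n1) = F 0 ->
  forall m, pi m = 0 -> F m = F 0.

Section Connectivity.
Variables (k : nat -> A) (P : pred A) (z : A).
Hypothesis pik : forall i, pi (k i) = sg i + sg i.+1.
Hypothesis walk_neq0 : walk k L 0 != 0.
(* The lifted arcs [z -> w] and [x -> y] are exchanged for [z -> y], which
   stands for the path through the kernel, and [x -> w]. *)
Let w := k L.-1 - z.
Let x := w + n1 - n0.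
Let y := k 0%N - x.
Hypothesis piz : pi z = sg L.-1.
Hypothesis P_arc : forall i u, (i < L)%N -> pi u = sg i ->
  (i, u) != (0%N, x) -> (i, u) != (L.-1, z) -> P u = P (k i - u).
Hypotheses (Pzy : P z = P y) (Pxw : P x = P w).

Lemma pi_walk i u : (pi (walk k i u) == sg i) = (pi u == sg 0).
Proof.
elim: i => //= i <-; rewrite raddfB /= pik -subr_eq0 -[in RHS]subr_eq0 -oppr_eq0.
by congr (_ == 0); zmodule.
Qed.

Lemma walk_inj i : injective (walk k i).
Proof. by elim: i => //= i IHi u v /addrI/oppr_inj/IHi. Qed.

Lemma walk_surj i v : pi v = sg i -> exists2 u, pi u = sg 0 & walk k i u = v.
Proof.
elim: i v => [|i IHi] v piv; first by exists v.
have [|u piu uE] := IHi (k i - v).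
  by rewrite raddfB /= pik piv; zmodule.
by exists u => //=; rewrite uE; zmodule.
Qed.

(** The lifted walks carry [P] along the circuit except at the two deleted arcs. Once [P x = P y] is
    known, the new arcs make up for these, so that [P] is constant on the fibre of [x], and every
    other fibre is reached from it. *)
Lemma lift_connected v : pi v != 0 -> P v = P x.
Proof.
have pix : pi x = sg 0.
  rewrite /x /w !(raddfB, raddfD) /= pik pin0 pin1 prednK ?sgL ?piz; last by lia.
  by zmodule.
have P_walk i u : (0 < i < L)%N -> pi u = sg 0 -> P (walk k i u) = P (walk k 1 u).
  elim: i => // i IHi ltiL piu; case: i IHi ltiL => // i IHi ltiL.
  rewrite -IHi //; last by lia.
  rewrite [RHS](@P_arc i.+1) //; first by lia.
  - by apply/eqP; rewrite pi_walk piu.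
  - by rewrite xpair_eqE; apply/nandP; left; lia.
have P_walk1 u : pi u = sg 0 -> u != x -> P u = P (walk k 1 u).
  move=> piu ux; apply: (@P_arc 0%N) => //; rewrite ?xpair_eqE ?negb_and ?ux //.
    by lia.
  by apply/orP; left; lia.
(* Each nonzero vertex of [Q] is visited twice, so the fibre of [x] recurs at a step [j] other than
   0. *)
have [j ltjL sgj] : exists2 j, (0 < j < L)%N & sg j = sg 0.
  have L0 : (0 < L)%N by lia.
  have := sg_count (sg 0); rewrite (bigD1 (Ordinal L0)) //= eqxx.
  have -> : sg 0 != 0 by apply: sg_neq0 sg_count _ _.
  have [/existsP[i /andP[i0 /eqP sgi]] _ | /existsPn no] :=
      boolP [exists i : 'I_L, (i != Ordinal L0) && (sg i == sg 0)].
    by exists i => //; rewrite ltn_ord andbT lt0n.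
  rewrite big1 // => i i0; apply/eqP; rewrite eqb0; apply/negP => sgi.
  by have := no i; rewrite i0 sgi.
(* Both occurrences of the fibre of [x] list the same vertices, so [P] holds
   equally often on them, while they agree copy by copy except perhaps at [x]. *)
have Px : P x = P (walk k 1 x).
  have : (\sum_(u | pi u == sg 0) P u = \sum_(u | pi u == sg 0) P (walk k 1 u))%N.
    rewrite (reindex_inj (@walk_inj j)) /=.
    under eq_bigl do rewrite -[in X in _ == X]sgj pi_walk.
    by apply: eq_bigr => u /eqP piu; rewrite P_walk.
  rewrite (bigD1 x) ?pix //= [RHS](bigD1 x) ?pix //=.
  have -> : (\sum_(u | (pi u == sg 0) && (u != x)) P u =
             \sum_(u | (pi u == sg 0) && (u != x)) P (walk k 1 u))%N.
    by apply: eq_bigr => u /andP[/eqP piu ux]; rewrite P_walk1.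
  by move/addIn; case: (P x); case: (P _).
have P_walk01 u : pi u = sg 0 -> P u = P (walk k 1 u).
  by move=> piu; have [-> // | ux] := eqVneq u x; apply: P_walk1.
pose g := walk k L 0.
have walkL u : walk k L u = u + g by rewrite walkE (negPf L_even) addrC.
have P_shift u : pi u = sg 0 -> P (u + g) = P u.
  move=> piu; rewrite -walkL -[in walk k L u](@prednK L) /=; last by lia.
  have PL : P (walk k L.-1 u) = P u by rewrite P_walk -?P_walk01 //; lia.
  (* At [z], where the last step lacks its arc to [w], [P] is carried along [z], [y], [x], [w]
     instead. *)
  have [uz | uz] := eqVneq (walk k L.-1 u) z.
    by rewrite uz -/w -Pxw Px -PL uz Pzy.
  rewrite -(@P_arc L.-1) ?PL //; first by lia.
  - by apply/eqP; rewrite pi_walk piu.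
  - by rewrite xpair_eqE; apply/nandP; left; lia.
  - by rewrite xpair_eqE negb_and uz orbT.
have pig : pi g = 0.
  have : pi (walk k L x) = sg L by apply/eqP; rewrite pi_walk pix.
  by rewrite walkL raddfD /= pix sgL => /eqP; rewrite addrC -subr_eq0 addrK => /eqP.
have P_fibre u : pi u = sg 0 -> P u = P x.
  move=> piu; have piF m : pi m = 0 -> pi (x + m) = sg 0.
    by move=> pim; rewrite raddfD /= pim addr0.
  suff : P (x + (u - x)) = P (x + 0) by rewrite addr0 [x + _]addrC subrK.
  apply: (@ker_connected g pig walk_neq0 (fun m => P (x + m))).
  - by move=> m pim; rewrite addrA P_shift // piF.
  - by rewrite addr0 Pxw; congr (P _); rewrite /x; zmodule.
  - by rewrite raddfB /= piu pix subrr.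
move=> piv; have [i ltiL sgi] : exists2 i, (i < L)%N & sg i = pi v.
  have := sg_count (pi v); rewrite piv.
  have [/existsP[i /eqP sgi] _ | /existsPn no] := boolP [exists i : 'I_L, sg i == pi v].
    by exists i.
  by rewrite big1 // => i _; have := no i => /negPf->.
have [u piu <-] := walk_surj (esym sgi).
case: i ltiL {sgi} => [|i] ltiL; first exact: P_fibre.
by rewrite P_walk // -P_walk01 // P_fibre.
Qed.

End Connectivity.

Lemma exists_Rstar_lift (tl : seq A) :
    last n0 tl = n1 ->
    (forall v, count_mem v (n0 :: tl) = ((pi v == 0) && (v != 0)).*2) ->
    (forall v, count_mem v (differences (cyclic_arcs (n0 :: tl)))
       = ((pi v == 0) && (v != 0)).*2) ->
    (exists a b r, n0 :: tl = [:: a, a + b, b & r]) ->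
  exists s : seq A, doubly_Rstar s.
Proof.
move=> last_tl count_N count_dN [a [b [r rstarN]]].
have [k [pik diff_count k0 walk0]] := exists_multipliers repK sg_count dsg_count
  sgL L_gt3 L_even sg0 pit pih h2 pin0 pin1 t_count.
pose z := rep (sg L.-1); pose w := k L.-1 - z.
pose x := w + n1 - n0; pose y := k 0%N - x.
have piz : pi z = sg L.-1 by rewrite repK.
have pix : pi x = sg 0.
  rewrite /x /w !(raddfB, raddfD) /= pik pin0 pin1 prednK ?sgL ?piz; last by lia.
  by zmodule.
have [L0 L1] : (0 < L)%N /\ (L.-1 < L)%N by lia.
pose o0 := Ordinal L0; pose oL := Ordinal L1.
pose J := [pred p : 'I_L * A | pi p.2 == sg p.1].
pose J' := [pred p | [&& J p, p != (o0, x) & p != (oL, z)]].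
pose arc (p : 'I_L * A) := (p.2, k p.1 - p.2).
have oLo0 : (oL == o0) = false by rewrite -val_eqE /=; lia.
have permJ : perm_eq (enum J) [:: (oL, z), (o0, x) & enum J'].
  apply: uniq_perm; rewrite /= ?enum_uniq // ?inE ?mem_enum ?inE ?eqxx ?andbF.
    by rewrite xpair_eqE oLo0.
  move=> p; rewrite !inE !mem_enum !inE.
  have [-> | pL] := eqVneq p (oL, z); first by rewrite /= piz eqxx.
  have [-> | p0] := eqVneq p (o0, x); first by rewrite /= pix eqxx.
  by rewrite andbT.
have countJ (f : 'I_L * A -> A) v : count_mem v [seq f p | p <- enum J] =
    (\sum_(i < L) \sum_(u : A) ((pi u == sg i) && (f (i, u) == v)))%N.
  rewrite count_map -sum1_count big_enum_cond /= big_mkcond pair_bigA /=.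
  by apply: eq_bigr => -[i u] _; rewrite !inE /=; case: (_ && _).
have count1 v : count_mem v (map fst (map arc (enum J))) = (pi v != 0).*2.
  rewrite -map_comp countJ -sg_count; apply: eq_bigr => i _.
  rewrite (bigD1 v) //= eqxx andbT big1 ?addn0 => [|u /negPf->]; last by rewrite andbF.
  by rewrite eq_sym.
have count2 v : count_mem v (map snd (map arc (enum J))) = (pi v != 0).*2.
  have <- : (\sum_(i < L) (sg i.+1 == pi v) = (pi v != 0%R).*2)%N.
    rewrite -sg_count -(prednK L0) big_ord_recr big_ord_recl /= prednK //.
    by rewrite sgL addnC.
  rewrite -map_comp countJ; apply: eq_bigr => i _.
  rewrite (bigD1 (k i - v)) //= big1 => [|u uv].
    rewrite subKr eqxx andbT addn0 raddfB /= pik; congr nat_of_bool.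
    rewrite -subr_eq0 -[in RHS]subr_eq0; congr (_ == 0); zmodule.
  suff /negPf-> : k i - u != v by rewrite andbF.
  by apply: contraNneq uv => <-; rewrite subKr.
have countd v : count_mem v (differences (map arc (enum J))) = (pi v != 0).*2.
  rewrite /differences -map_comp countJ -diff_count; apply: eq_bigr => i _.
  apply: eq_bigr => u _ /=; congr (nat_of_bool (_ && (_ == _))); zmodule.
pose R := map arc (enum J').
have permE : perm_eq (map arc (enum J)) [:: (z, w), (x, y) & R].
  exact: (perm_map arc permJ).
have /seq.permP perm1 := perm_map fst permE.
have /seq.permP perm2 := perm_map snd permE.
have /seq.permP permd := perm_map (fun e => e.2 - e.1) permE.
(* The virtual arc [z -> y] is where the circuit is opened; the sequence [n0 :: tl] then fills the
   gap. *)
have [||T [lastT permT]] := @eulerian_bypass _ ((x, w) :: R) z y.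
- apply/allP => v _ /=; apply/eqP.
  have := count1 v; have := count2 v; rewrite perm1 perm2 /= => <-.
  by rewrite [X in _ -> _ = X]addnCA.
- move=> P P_arc u v uE vE.
  have pi_E u' : u' \in unzip1 [:: (z, y), (x, w) & R] -> pi u' != 0.
    move=> u'E; have : u' \in unzip1 (map arc (enum J)).
      by rewrite (perm_mem (perm_map fst permE)).
    by rewrite -has_pred1 has_count count1; case: (pi u' != 0).
  have conn u' : pi u' != 0 -> P u' = P x.
    apply: (lift_connected pik walk0 piz).
    - move=> i u1 ltiL piu1 ne0 neL.
      pose o := Ordinal ltiL.
      apply: (P_arc (arc (o, u1))); rewrite !inE map_f ?orbT //.
      rewrite mem_enum !inE piu1 eqxx /=.
      by move: ne0 neL; rewrite !xpair_eqE -!val_eqE /= => -> ->.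
    - by apply: (P_arc (z, y)); rewrite mem_head.
    - by apply: (P_arc (x, w)); rewrite !inE eqxx orbT.
  by rewrite !conn ?pi_E.
have split_nz v :
    (((pi v == 0%R) && (v != 0%R)).*2 + (pi v != 0%R).*2 = (v != 0%R).*2)%N.
  by have [-> | _] := eqVneq v 0; rewrite ?raddf0 ?eqxx //; case: (pi v == 0).
exists ((n0 :: tl) ++ y :: T); split.
- move=> v; rewrite count_cat count_N -split_nz.
  have /seq.permP/(_ (pred1 v)) := perm_map snd permT.
  have := count2 v; rewrite perm2 [map snd (pairmap _ _ _)]unzip2_pairmap /=.
  by move=> <- ->; rewrite [X in _ = (_ + X)%N]addnCA.
- move=> v; rewrite /differences /cyclic_arcs last_cat /= lastT pairmap_cat last_tl.
  have /seq.permP/(_ (pred1 v)) := perm_map (fun e => e.2 - e.1) permT.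
  rewrite map_cat count_cat /= => ->.
  have -> : n0 - z = y - x by rewrite /y k0 /x /w; zmodule.
  have -> : y - n1 = w - z by rewrite /y k0 /x /w; zmodule.
  have -> : w - x = n0 - n1 by rewrite /x; zmodule.
  have := countd v; rewrite /differences permd /= -split_nz => <-.
  have := count_dN v; rewrite /differences /cyclic_arcs /= last_tl => <-.
  have arith (i j l m o : nat) : (i + (j + (l + (m + o))) = m + j + (l + (i + o)))%N.
    by lia.
  exact: arith.
by exists a, b, (r ++ y :: T); rewrite rstarN.
Qed.

End Lift.

Lemma sum_nth_belast (V : zmodType) (x : V) s q :
  (\sum_(i < size s) (nth 0%R (x :: s) i == q) = count_mem q (belast x s))%N.
Proof.
elim: s x => [|y s IHs] x; first by rewrite big_ord0.
by rewrite /= big_ord_recl /= IHs.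
Qed.

Lemma sum_nth_differences (V : zmodType) (x : V) s q :
  (\sum_(i < size s) (nth 0 (x :: s) i.+1 - nth 0 (x :: s) i == q)%R
   = count_mem q (differences (pairmap pair x s)))%N.
Proof.
elim: s x => [|y s IHs] x; first by rewrite big_ord0.
by rewrite /= big_ord_recl /= IHs.
Qed.

Lemma Rstar_extension (N A Q : finZmodType)
    (iota : {additive N -> A}) (pi : {additive A -> Q})
    (sQ : seq Q) (n0 : N) (tl : seq N) (t h : N) :
    injective iota -> (forall q, exists u, pi u = q) ->
    (forall u, pi u = 0 <-> exists m, iota m = u) ->
    (2 < #|Q|)%N -> doubly_Rstar sQ -> doubly_Rstar (n0 :: tl) ->
    h *+ 2 != 0 ->
    (forall y, \sum_(m : N) (m *+ 2 == y)%R + \sum_(m : N) (m *+ 2 == y + t)%R = 2)%N ->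
    (forall g, g != 0 -> forall F : pred N, (forall m, F (m + g) = F m) ->
       F (n0 - last n0 tl) = F 0 -> forall m, F m = F 0) ->
  exists s : seq A, doubly_Rstar s.
Proof.
move=> iota_inj pi_surj pi_ker Q_gt2 [countQ dcountQ [a [b [r sQE]]]].
move=> [countN dcountN [a' [b' [r' sNE]]]] h2 t_count ker_conn.
pose rep q := odflt 0 [pick u | pi u == q].
have repK q : pi (rep q) = q.
  rewrite /rep; case: pickP => [u /eqP // | no]; have [u piu] := pi_surj q.
  by have := no u; rewrite piu eqxx.
have pi_iota m : pi (iota m) = 0 by apply/pi_ker; exists m.
have ker_iota u : pi u = 0 -> exists m, iota m = u by move/pi_ker.
(* The circuit of [Q] is rotated to start and end at [a + b], so that [sg L.-1], [sg 0], [sg 1] are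
   [a], [a + b], [b]. *)
pose s := rcons (b :: rcons r a) (a + b); pose L := size s.
pose sg i := nth 0 (a + b :: s) i.
have sg_count q : (\sum_(i < L) (sg i == q) = (q != 0%R).*2)%N.
  rewrite sum_nth_belast belast_rcons -countQ sQE /= -cats1 count_cat /=.
  have arith (i j k l : nat) : (i + (j + (k + (l + 0))) = l + (i + (j + k)))%N by lia.
  exact: arith.
have dsg_count q : (\sum_(i < L) ((sg i.+1 - sg i)%R == q) = (q != 0%R).*2)%N.
  rewrite sum_nth_differences -dcountQ sQE /cyclic_arcs /s /=.
  rewrite -!cats1 !pairmap_cat /differences /= !map_cat !count_cat /=.
  rewrite last_cat /=.
  have arith (i j k l m : nat) : (i + (j + (k + 0) + (l + 0)) = k + (l + (i + j)))%N.
    by lia.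
  exact: arith.
have L2 : (L = (#|Q|.-1).*2)%N.
  have : (\sum_(i < L) \sum_(q : Q) (sg i == q) = L)%N.
    rewrite -[RHS]card_ord -sum1_card; apply: eq_bigr => i _.
    by rewrite (bigD1 (sg i)) //= eqxx big1 // => q; rewrite eq_sym => /negPf->.
  rewrite exchange_big; under eq_bigr do rewrite sg_count -muln2.
  rewrite -big_distrl /= muln2 => <-; congr _.*2.
  have := cardC1 (0 : Q); rewrite -sum1_card big_mkcond /= => <-.
  by apply: eq_bigr => q _; rewrite inE.
have last_sg : sg L.-1 = a.
  by rewrite /sg /L /s size_rcons /= size_rcons /= !nth_rcons size_rcons ltnSn ltnn eqxx.
have count_iota (l : seq N) v : (forall m, count_mem m l = (m != 0).*2) ->
    count_mem v (map iota l) = ((pi v == 0) && (v != 0)).*2.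
  move=> countl; have [/ker_iota[m <-] | piv] := eqVneq (pi v) 0.
    rewrite count_map -(raddf0 iota) (inj_eq iota_inj) -countl.
    by apply: eq_count => m' /=; rewrite (inj_eq iota_inj).
  apply/count_memPn/mapP => -[m _ vE]; case/eqP: piv; by rewrite vE.
have sum_iota (F : pred A) :
    (\sum_(u : A) ((pi u == 0%R) && F u) = \sum_(m : N) F (iota m))%N.
  transitivity (\sum_(u in iota @: [set: N]) F u)%N; last first.
    by rewrite big_imset => [|? ? _ _ /iota_inj//]; apply: eq_bigl => m; rewrite inE.
  rewrite [RHS]big_mkcond; apply: eq_bigr => u _ /=; case: eqP => piu.
    by have [m <-] := ker_iota u piu; rewrite imset_f.
  by case: imsetP => // -[m _ uE]; case: piu; rewrite uE.
have diff_iota : differences (cyclic_arcs (map iota (n0 :: tl))) =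
    map iota (differences (cyclic_arcs (n0 :: tl))).
  rewrite /cyclic_arcs /=; rewrite last_map.
  rewrite raddfB; congr (_ :: _).
  elim: tl (n0) {dcountN countN sNE ker_conn} => //= n l IHl n1.
  by rewrite raddfB IHl.
apply: (@exists_Rstar_lift A Q pi rep L sg (iota t) (iota h) (iota n0)
  (iota (last n0 tl)) repK sg_count dsg_count) (map iota tl) _ _ _ _.
all: rewrite ?pi_iota //.
- by rewrite /sg /L /s size_rcons /= nth_rcons ltnn eqxx.
- by rewrite L2; lia.
- by rewrite L2 odd_double.
- by rewrite last_sg /sg /s /= addrC.
- by rewrite -raddfMn /= -(raddf0 iota) (inj_eq iota_inj).
- move=> _ /ker_iota[y <-]; rewrite !sum_iota -[RHS](t_count y).
  by congr addn; apply: eq_bigr => m _;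
     rewrite -raddfMn /= -?raddfD /= (inj_eq iota_inj).
- move=> _ /ker_iota[g <-]; rewrite -(raddf0 iota) (inj_eq iota_inj) => g0 F FD F0.
  move=> _ /ker_iota[m <-]; apply: (ker_conn g g0 (fun m => F (iota m))).
    by move=> m1; rewrite raddfD /= FD.
  by rewrite raddfB.
- by rewrite last_map.
- by move=> v; apply: (count_iota (n0 :: tl)).
- by move=> v; rewrite (diff_iota : differences (cyclic_arcs (_ :: _)) = _) count_iota.
- exists (iota a'), (iota b'), (map iota r'); rewrite -raddfD.
  by rewrite -[LHS]/(map iota (n0 :: tl)) sNE.
Qed.

(** * Finite fields *)

(** Contracting the path [a], [a + b], [b] to one arc keeps the graph balanced. Opening an Eulerian
    circuit at this arc gives a trail from [b] to [a] along [E], which the path closes up. *)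
Lemma Rstar_of_graph (A : finZmodType) (E : seq (A * A)) (a b : A) :
    let F := [:: (a, a + b), (a + b, b) & E] in
    E != [::] -> doubly_covers (unzip1 F) -> doubly_covers (unzip2 F) ->
    doubly_covers (differences F) ->
    (forall P : pred A, {in E, forall e, P e.1 = P e.2} ->
      forall v w, v != 0 -> w != 0 -> P v = P w) ->
  exists s : seq A, doubly_Rstar s.
Proof.
move=> /= E0 E1 E2 Ed conn.
have [||T [lastT permT]] := @eulerian_bypass _ E a b.
- apply/allP => v _ /=; apply/eqP/(@addnI (a + b == v)).
  by have := E1 v; rewrite /= -(E2 v) /= addnCA.
- move=> P PE v w vE wE.
  have E_neq0 u : u \in unzip1 ((a, b) :: E) -> u != 0.
    rewrite /= inE => uE; have : (0 < (u != 0%R).*2)%N.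
      by rewrite -E1 -has_count has_pred1 !inE orbCA uE orbT.
    by case: (u != 0).
  by apply: conn; [move=> e eE; apply: PE; rewrite inE eE orbT | exact: E_neq0..].
case: (lastP T) lastT permT => [|T' a' lastT permT].
  by move=> _ /perm_size; case: (E) E0.
move: lastT permT; rewrite last_rcons => -> permT.
exists [:: a, a + b, b & T']; split; last by exists a, b, T'.
- move=> v; rewrite -(E2 v) /=.
  have /seq.permP/(_ (pred1 v)) := perm_map snd permT.
  rewrite [map snd (pairmap _ _ _)]unzip2_pairmap -cats1 count_cat /= => <-.
  have arith (i j k l : nat) : (i + (j + (k + l)) = j + (k + (l + (i + 0))))%N by lia.
  exact: arith.
- move=> v; rewrite -(Ed v) /= /cyclic_arcs /differences /=.
  have /seq.permP/(_ (pred1 v)) := perm_map (fun e => e.2 - e.1) permT.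
  rewrite -cats1 pairmap_cat map_cat count_cat /= => <-.
  have arith (i j k l : nat) : (i + (j + (k + l)) = j + (k + (l + (i + 0))))%N by lia.
  exact: arith.
Qed.

Section CountInjective.
Variables (F V : finType) (f : F -> V).
Hypothesis f_bij : bijective f.

(** The value at the omitted point stays a separate summand, which reduces the covering conditions
    to linear arithmetic. *)
Lemma count_map_enum1 (a : F) (v : V) :
  ((f a == v) + count_mem v [seq f x | x <- enum [pred x | x != a]] = 1)%N.
Proof.
have <- : count_mem v [seq f x | x <- enum F] = 1%N.
  rewrite count_uniq_mem ?(map_inj_uniq (bij_inj f_bij)) ?enum_uniq //.
  by case: f_bij => g _ gK; rewrite -[v]gK map_f ?mem_enum.
rewrite -[LHS]/(count_mem v (map f (a :: enum [pred x | x != a]))).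
apply/seq.permP/perm_map/uniq_perm; rewrite /= ?enum_uniq ?mem_enum ?inE ?eqxx //.
by move=> x; rewrite !inE !mem_enum !inE; case: (x == a).
Qed.

Lemma count_map_enum2 (a b : F) (v : V) : a != b ->
  ((f a == v) + ((f b == v) +
     count_mem v [seq f x | x <- enum [pred x | (x != a) && (x != b)]]) = 1)%N.
Proof.
move=> ab; rewrite -[RHS](count_map_enum1 a v); congr (_ + _)%N.
rewrite -[LHS]/(count_mem v (map f (b :: enum [pred x | (x != a) && (x != b)]))).
apply/seq.permP/perm_map/uniq_perm; rewrite /= ?enum_uniq ?mem_enum ?inE ?eqxx ?andbF //.
move=> x; rewrite !inE !mem_enum !inE.
by have [-> | _] := eqVneq x b; rewrite ?andbT // eq_sym ab.
Qed.

End CountInjective.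

Lemma mulr_bij (F : fieldType) (a : F) : a != 0 -> bijective (fun x => a * x).
Proof. by exists (fun x => a^-1 * x) => x; field. Qed.

Lemma exists_field_generator (F : finFieldType) :
  exists g : F, g != 0 /\ forall x, x != 0 -> exists i, x = g ^+ i.+1.
Proof.
have /cyclicP[u uE] := field_unit_group_cyclic [set: {unit F}].
exists (val u); split=> [|x x0]; first by rewrite -unitfE (valP u).
have Ux : x / val u \is a GRing.unit.
  by rewrite unitfE mulf_neq0 ?invr_eq0 -?unitfE ?(valP u) ?unitfE.
have /cycleP[i xE] : FinRing.unit F Ux \in <[u]>%g by rewrite -uE inE.
exists i; rewrite exprSr -FinRing.val_unitX -xE /= divfK // -unitfE; exact: (valP u).
Qed.

(** Without its arc from 1, the cycle of powers is still a path from [g] to 1. *)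
Lemma field_path_connected (F : finFieldType) (g : F) (P : pred F) :
    (forall x, x != 0 -> exists i, x = g ^+ i.+1) ->
    (forall x, x != 0 -> x != 1 -> P x = P (g * x)) ->
  forall x, x != 0 -> P x = P g.
Proof.
move=> gen Pg x x0; have [i ->] := gen x x0; have g0 : g != 0.
  have [j jE] := gen 1 (oner_neq0 _).
  by apply: contra_eq_neq jE => ->; rewrite expr0n oner_neq0.
elim: i => [|i IHi]; first by rewrite expr1.
have [gi1 | gi1] := eqVneq (g ^+ i.+1) 1; first by rewrite exprS gi1 mulr1.
by rewrite exprS -Pg ?expf_neq0.
Qed.

Lemma field_Rstar (F : finFieldType) : (2 < #|F|)%N -> exists s : seq F, doubly_Rstar s.
Proof.
move=> F_gt2; have [g [g0 gen]] := exists_field_generator F.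
have g1 : g != 1.
  apply: contraTneq F_gt2 => g1; rewrite -leqNgt.
  have /subset_leq_card : [set: F] \subset [set 0; 1].
    apply/subsetP => x _; rewrite !inE; have [//| /gen[i ->]] := eqVneq x 0.
    by rewrite g1 expr1n eqxx.
  by rewrite cardsT cards2 => /leq_trans; apply; case: (0 != 1).
(* The choice gives [c * g = g - 1], so the omitted arcs [1 -> g] and [g -> g - 1] form the R*
   triple with [a = 1] and [b = g - 1]. The factor [c - 1 = - g^-1] of the differences is
   nonzero. *)
pose c := (g - 1) / g.
have c0 : c != 0 by rewrite mulf_neq0 ?subr_eq0 ?invr_eq0.
pose E1 := [seq (x, g * x) | x <- enum [pred x | (x != 0) && (x != 1)]].
pose E2 := [seq (x, c * x) | x <- enum [pred x | (x != 0) && (x != g)]].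
have bij_id : bijective (@id F) by exists id.
have bij_g := mulr_bij g0.
have bij_c := mulr_bij c0.
have bij_dg : bijective (fun x => g * x - x).
  by apply: eq_bij (mulr_bij (_ : g - 1 != 0)) _ _ => [|x]; [rewrite subr_eq0 | ring].
have bij_dc : bijective (fun x => c * x - x).
  apply: eq_bij (mulr_bij (_ : - g^-1 != 0)) _ _ => [|x].
    by rewrite oppr_eq0 invr_eq0.
  by rewrite /c; field.
have cover (f1 f2 : F -> F) (e1 e2 : F) : bijective f1 -> bijective f2 ->
    f1 0 = 0 -> f2 0 = 0 -> f1 1 = e1 -> f2 g = e2 ->
    doubly_covers [:: e1, e2 &
      [seq f1 x | x <- enum [pred x | (x != 0) && (x != 1)]] ++
      [seq f2 x | x <- enum [pred x | (x != 0) && (x != g)]]].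
  move=> bij1 bij2 f10 f20 <- <- v; rewrite /= count_cat.
  have n01 : 0 != 1 :> F by rewrite eq_sym oner_neq0.
  have n0g : 0 != g by rewrite eq_sym.
  have := count_map_enum2 bij1 v n01; have := count_map_enum2 bij2 v n0g.
  rewrite f10 f20 [0 == v]eq_sym => H2 H1.
  have arith (i j k l : nat) (m : bool) : (m + (j + l) = 1 -> m + (i + k) = 1 ->
    j + (i + (l + k)) = (~~ m).*2)%N by case: m; lia.
  exact: arith H1 H2.
apply: (@Rstar_of_graph F (E1 ++ E2) 1 (g - 1)).
- have : (g, g * g) \in E1 ++ E2 by rewrite mem_cat map_f // mem_enum inE g0.
  by case: (E1 ++ E2).
- rewrite /= addrC subrK /unzip1 map_cat -!map_comp.
  by apply: (cover id id).
- rewrite /= addrC subrK /unzip2 map_cat -!map_comp.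
  by apply: (cover (fun x => g * x) (fun x => c * x)); rewrite ?mulr0 ?mulr1 // divfK.
- rewrite /differences /= [1 + (g - 1)]addrC subrK map_cat -!map_comp.
  by apply: (cover (fun x => g * x - x) (fun x => c * x - x));
    rewrite ?mulr0 ?mulr1 ?subrr // divfK.
move=> P PE v w v0 w0; suff Pg x : x != 0 -> P x = P g by rewrite !Pg.
apply: field_path_connected gen _ x => x x0 x1; apply: (PE (x, g * x)).
by rewrite mem_cat map_f // mem_enum inE x0.
Qed.

(** * Products, and the group [Z_2 * F] for a field [F] with [2 != 0] *)

HB.instance Definition _ (A B : finZmodType) := GRing.Zmodule.on (A * B)%type.

Lemma affine_bij (F : fieldType) (a b : F) : a != 0 -> bijective (fun x => a * x + b).
Proof. by exists (fun x => a^-1 * (x - b)) => x; field. Qed.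

Lemma count_map_pair (A B : eqType) (C : Type) (f : C -> B) (i j : A) (w : B) (l : seq C) :
  count_mem (i, w) [seq (j, f x) | x <- l] = ((j == i) * count_mem w (map f l))%N.
Proof.
rewrite !count_map; case: eqP => [-> | ji]; rewrite ?mul1n ?mul0n.
  by apply: eq_count => x /=; rewrite xpair_eqE eqxx.
rewrite (@eq_count _ _ pred0) ?count_pred0 // => x /=.
by rewrite xpair_eqE (introF eqP ji).
Qed.

Lemma Z2_cases (i : 'Z_2) : i = 0 \/ i = 1.
Proof. by case: i => [[|[|i]] lti] //; [left | right]; apply: val_inj. Qed.

Lemma Z2_field_Rstar (F : finFieldType) : (2 : F) != 0 ->
  exists s : seq ('Z_2 * F)%type, doubly_Rstar s.
Proof.
move=> F2; have [g [g0 gen]] := exists_field_generator F.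
have m1_neq1 : (-1 : F) != 1.
  by rewrite -subr_eq0 -opprD oppr_eq0.
have g1 : g - 1 != 0.
  rewrite subr_eq0; apply: contraNneq m1_neq1 => g1.
  by have [i ->] := gen (-1) ltac:(by rewrite oppr_eq0 oner_neq0); rewrite g1 expr1n.
have g1' : 1 - g != 0 by rewrite -opprB oppr_eq0.
pose u := g - 1; pose r := g / (g - 1).
have r0 : r != 0 by rewrite mulf_neq0 ?invr_eq0.
pose pA := [pred x : F | (x != 0) && (x != 1)].
pose pB := [pred x : F | (x != 0) && (x != u)].
pose pC := [pred x : F | x != g].
pose pD := [pred x : F | (x != 0) && (x != 1 - g)].
pose V := ('Z_2 * F)%type.
(* [EA] is the cycle [x |-> g x] without its arc [1 -> g]; [EB], [EC] and [ED]
   come from affine bijections between the cosets, with the arcs that would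
   meet [(0, 0)] redirected by [E0].  The arcs of the R* triple
   [(0, 1) -> (1, 1 - g) -> (1, - g)] are left out. *)
pose EA : seq (V * V) := [seq ((0, x), (0, g * x)) | x <- enum pA].
pose EB : seq (V * V) := [seq ((0, x), (1, 2 * x + (1 - g))) | x <- enum pB].
pose EC : seq (V * V) := [seq ((1, x), (0, -1 * x + g)) | x <- enum pC].
pose ED : seq (V * V) := [seq ((1, x), (1, r * x)) | x <- enum pD].
pose E0 : seq (V * V) := [:: ((0, u), (1, 0)); ((1, g), (0, g)); ((1, 0), (1, u))].
pose E := E0 ++ EA ++ EB ++ EC ++ ED.
have n01 : 0 != 1 :> F by rewrite eq_sym oner_neq0.
have n0u : 0 != u by rewrite eq_sym.
have n01g : 0 != 1 - g by rewrite eq_sym.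
have bij_id : bijective (@id F) by exists id.
have bij (a b : F) (f : F -> F) : a != 0 -> (forall x, f x = a * x + b) -> bijective f.
  by move=> a0 fE; apply: eq_bij (affine_bij b a0) _ _ => x; rewrite fE.
have N1 : (-1 : F) != 0 by rewrite oppr_eq0 oner_neq0.
(* [e] is the indicator of [w], and [cA] to [cD] count the occurrences of [w] in the four families.
   The last term of the total compensates for [(0, 0)], which must not be covered. *)
have cover (l : seq V) (lA lB lC lD : F -> F) (jA jB jC jD : 'Z_2) :
    bijective lA -> bijective lB -> bijective lC -> bijective lD ->
    (forall w (e : F -> nat) (cA cB cC cD : nat), (forall x, (x == w) = e x :> nat) ->
      e (lA 0%R) + (e (lA 1%R) + cA) = 1 -> e (lB 0%R) + (e (lB u) + cB) = 1 ->
      e (lC g) + cC = 1 -> e (lD 0%R) + (e (lD (1 - g)%R) + cD) = 1 ->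
      forall i : 'Z_2, count_mem (i, w) l + ((jA == i) * cA + ((jB == i) * cB +
        ((jC == i) * cC + (jD == i) * cD))) + (i == 0%R) * (e 0%R).*2 = 2)%N ->
    doubly_covers (l ++ [seq (jA, lA x) | x <- enum pA] ++
      [seq (jB, lB x) | x <- enum pB] ++ [seq (jC, lC x) | x <- enum pC] ++
      [seq (jD, lD x) | x <- enum pD]).
  move=> bA bB bC bD tot [i w]; rewrite !count_cat !count_map_pair.
  have := tot w (fun x => x == w) _ _ _ _ (fun=> erefl) (count_map_enum2 bA w n01)
    (count_map_enum2 bB w n0u) (count_map_enum1 bC g w) (count_map_enum2 bD w n01g) i.
  rewrite [0 == w]eq_sym xpair_eqE.
  have arith (m n : nat) (b1 b2 : bool) :
    (m + n + b1 * b2.*2 = 2 -> m + n = (~~ (b1 && b2)).*2)%N by clear; case: b1 b2 => -[] /=; lia.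
  exact: arith.
have ab : (0, 1) + (1, - g) = (1, 1 - g) :> V by congr pair; rewrite add0r.
apply: (@Rstar_of_graph V E (0, 1) (1, - g)) => //; rewrite ?ab.
- rewrite /unzip1 /= !map_cat -!map_comp.
  apply: (cover [:: _; _; _; _; _] id id id id 0 0 1 1) => //.
  move=> w e cA cB cC cD eE HA HB HC HD i; rewrite /= !xpair_eqE.
  by have [->|->] := Z2_cases i; rewrite /= !eE; lia.
- rewrite /unzip2 /= !map_cat -!map_comp.
  apply: (cover [:: _; _; _; _; _] (fun x => g * x) (fun x => 2 * x + (1 - g))
    (fun x => -1 * x + g) (fun x => r * x) 0 1 0 1).
  + exact: mulr_bij.
  + exact: affine_bij.
  + exact: affine_bij.
  + exact: mulr_bij.
  have -> : -1 * g + g = 0 by ring.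
  have -> : 2 * u + (1 - g) = u by rewrite /u; ring.
  have -> : r * (1 - g) = - g by rewrite /r; field.
  rewrite !mulr0 mulr1 add0r.
  move=> w e cA cB cC cD eE HA HB HC HD i; rewrite /= !xpair_eqE.
  have arith0 (a b c d m n : nat) : (a + (b + c) = 1 -> a + d = 1 ->
      0 + (0 + (0 + (b + (0 + 0)))) + (1 * c + (0 * m + (1 * d + 0 * n))) + 1 * a.*2 = 2)%N.
    by clear; lia.
  have arith1 (a b c d m n k p : nat) : (a + (b + c) = 1 -> k + (d + p) = 1 ->
      a + (d + (k + (0 + (b + 0)))) + (0 * m + (1 * c + (0 * n + 1 * p))) + 0 * k.*2 = 2)%N.
    by clear; lia.
  by have [->|->] := Z2_cases i; rewrite /= !eE; [exact: arith0 | exact: arith1].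
- rewrite /differences /= !map_cat -!map_comp.
  pose dA x : F := (g - 1) * x; pose dB x : F := x + (1 - g).
  pose dC x : F := - 2 * x + g; pose dD x : F := (g - 1)^-1 * x.
  have : doubly_covers ([:: (1, - g); (0, -1); (1, 1 - g); (1, 0); (0, g - 1)] ++
     [seq (0 : 'Z_2, dA x) | x <- enum pA] ++ [seq (1 : 'Z_2, dB x) | x <- enum pB] ++
     [seq (1 : 'Z_2, dC x) | x <- enum pC] ++ [seq (0 : 'Z_2, dD x) | x <- enum pD]).
    apply: cover; rewrite /dA /dB /dC /dD.
    + exact: mulr_bij.
    + by apply: bij (oner_neq0 _) _ => x; rewrite mul1r.
    + by apply: affine_bij; rewrite oppr_eq0.
    + by apply: mulr_bij; rewrite invr_eq0.
    have -> : -2 * g + g = - g by ring.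
    have -> : u + (1 - g) = 0 by rewrite /u; ring.
    have -> : (g - 1)^-1 * (1 - g) = - 1 by field.
    rewrite !mulr0 mulr1 add0r.
    move=> w e cA cB cC cD eE HA HB HC HD i; rewrite /= !xpair_eqE.
    have arith0 (a b c d k m n : nat) : (a + (b + c) = 1 -> a + (d + k) = 1 ->
        0 + (d + (0 + (0 + (b + 0)))) + (1 * c + (0 * m + (0 * n + 1 * k))) + 1 * a.*2 = 2)%N.
      by clear; lia.
    have arith1 (a b c d m n k : nat) : (a + (b + c) = 1 -> k + d = 1 ->
        k + (0 + (a + (b + (0 + 0)))) + (0 * m + (1 * c + (1 * d + 0 * n))) + 0 * b.*2 = 2)%N.
      by clear; lia.
    by have [->|->] := Z2_cases i; rewrite /= !eE; [exact: arith0 | exact: arith1].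
  have pairB (i j : 'Z_2) (x y : F) : (i, x) - (j, y) = (i - j, x - y) :> V by [].
  congr doubly_covers; rewrite /= [in RHS]/u !pairB.
  congr [:: _, _, _, _, _ & _]; try by congr pair; [apply: val_inj | ring].
  do 3?congr (_ ++ _); apply: eq_map => x /=; rewrite pairB; congr pair;
    try (by apply: val_inj); rewrite /dA /dB /dC /dD /r; by [ring | field].
(* [EA] connects the nonzero points of the coset of 0, and every point of the other coset has an arc
   into them. *)
move=> P PE; have P_0 x : x != 0 -> P (0, x) = P (0, g).
  apply: (field_path_connected (P := fun x => P (0, x)) gen) => y y0 y1.
  apply: (PE ((0, y), (0, g * y))); rewrite !mem_cat map_f ?orbT //.
  by rewrite mem_enum inE y0.
have P_1 x : P (1, x) = P (0, g).
  have [-> | xg] := eqVneq x g; first by apply: (PE ((1, g), (0, g))); rewrite !inE eqxx !orbT.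
  rewrite -(P_0 (-1 * x + g)).
    by apply: (PE ((1, x), (0, -1 * x + g))); rewrite !mem_cat map_f ?orbT // mem_enum.
  by rewrite mulN1r addrC subr_eq0 eq_sym.
suff Pg (v : V) : v != 0 -> P v = P (0, g) by move=> v w v0 w0; rewrite !Pg.
case: v => i x; have [->|-> _] := Z2_cases i; last exact: P_1.
by rewrite xpair_eqE eqxx; apply: P_0.
Qed.

(** * Quotients and embeddings *)

Section AdditiveGroup.
Variables (gT : finGroupType) (abT : abelian [set: gT]).

(* The unused [abT] is what the instances of the alias below depend on. *)
Definition additive_group : Type := let _ := abT in gT.

HB.instance Definition _ := Finite.on additive_group.

Let add (x y : additive_group) : additive_group := (x * y : gT)%g.
Let opp (x : additive_group) : additive_group := (x^-1 : gT)%g.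
Let zero : additive_group := (1 : gT)%g.

Let addA : associative add. Proof. exact: mulgA. Qed.
Let addC : commutative add.
Proof. by move=> x y; apply: (centsP abT); rewrite inE. Qed.
Let add0 : left_id zero add. Proof. exact: mul1g. Qed.
Let addN : left_inverse zero opp add. Proof. exact: mulVg. Qed.

HB.instance Definition _ := GRing.isZmodule.Build additive_group addA addC add0 addN.

End AdditiveGroup.

Lemma exists_quotient (A : finZmodType) (H : {group A}) :
  exists (Q : finZmodType) (pi : {additive A -> Q}),
    [/\ forall q, exists u, pi u = q, forall u, pi u = 0 <-> u \in H &
        (#|Q| * #|H| = #|A|)%N].
Proof.
have abA : abelian [set: A] := FinRing.zmod_abelian _.
have nH u : u \in 'N(H)%g by rewrite (subsetP (sub_abelian_norm abA _)) ?subsetT ?inE.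
have QT : ([set: A] / H = [set: coset_of H])%g.
  by apply/setP => q; rewrite [RHS]inE; have [u Nu ->] := cosetP q; rewrite mem_quotient ?inE.
have abQ : abelian [set: coset_of H] by rewrite -QT quotient_abelian.
pose Q : finZmodType := additive_group abQ.
pose f (u : A) : Q := coset H u.
have fB : {morph f : u v / u - v}.
  by move=> u v; rewrite /f -[u - v]/(u * v^-1)%g morphM ?morphV ?nH.
pose pi : {additive A -> Q} := HB.pack f (GRing.isZmodMorphism.Build A Q f fB).
exists Q, pi; split.
- by move=> q; have [u _ ->] := cosetP (q : coset_of H); exists u.
- move=> u; split=> [|uH]; last exact: coset_id.
  by move/(coset_idr (nH u)).
- have -> : #|Q| = #|[set: A] : H|%g.
    rewrite -card_quotient ?QT ?cardsT //.
    by apply/subsetP => u _; apply: nH.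
  by rewrite mulnC -(cardsT A) Lagrange ?subsetT.
Qed.

Lemma exists_cyclic_embedding (A : finZmodType) (x : A) n : #[x]%g = n -> (1 < n)%N ->
  exists iota : {additive 'Z_n -> A},
    [/\ injective iota, iota 1 = x & forall u, u \in <[x]>%g <-> exists m, iota m = u].
Proof.
move=> xn n_gt1; pose f (m : 'Z_n) : A := x *+ m.
have f_mod m : x *+ (m %% n) = x *+ m.
  by apply/eqP; rewrite -[_ == _]/((x ^+ (m %% n) == x ^+ m)%g) eq_expg_mod_order xn modn_mod.
have fD : {morph f : i j / i + j}.
  move=> i j; rewrite /f -mulrnDr -[RHS]f_mod; congr (_ *+ _).
  by rewrite -[LHS]/((i + j) %% (Zp_trunc n).+2)%N; congr (_ %% _)%N; apply: Zp_cast.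
have f0 : f 0 = 0 by [].
pose iota : {additive 'Z_n -> A} :=
  HB.pack f (GRing.isNmodMorphism.Build 'Z_n A f (conj f0 fD)).
exists iota; split.
- move=> i j /eqP; rewrite -[_ == _]/((x ^+ i == x ^+ j)%g) eq_expg_mod_order xn.
  by rewrite !modn_small -?[X in (_ < X)%N](Zp_cast n_gt1) // => /eqP/val_inj.
- by rewrite /= /f /= modn_small ?mulr1n // Zp_cast.
- move=> u; split=> [/cycleP[i ->] | [m <-]]; last exact: mem_cycle.
  exists i%:R; rewrite /= /f val_Zp_nat // f_mod; exact: erefl.
Qed.

Lemma Rstar_additive_bij (A B : finZmodType) (f : {additive B -> A}) (s : seq B) :
  injective f -> #|A| = #|B| -> doubly_Rstar s -> doubly_Rstar (map f s).
Proof.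
move=> f_inj cardAB [cs cd [a [b [r sE]]]].
have cover (l : seq B) : doubly_covers l -> doubly_covers (map f l).
  move=> cl v; have [g _ gK] := inj_card_bij f_inj (eq_leq cardAB).
  rewrite -[v]gK count_map -(raddf0 f) (inj_eq f_inj) -cl.
  by apply: eq_count => u /=; rewrite (inj_eq f_inj).
split; first exact: cover.
- have -> : differences (cyclic_arcs (map f s)) = map f (differences (cyclic_arcs s)).
    rewrite /cyclic_arcs -[0 in LHS](raddf0 f) last_map.
    elim: s (last 0 s) {cs cd sE} => //= x s IHs y.
    by rewrite raddfB IHs.
  exact: cover.
- by exists (f a), (f b), (map f r); rewrite sE /= raddfD.
Qed.

(** The hypotheses make [A] the internal direct sum of the images of [f] and [g]. *)
Lemma Rstar_direct (A B C : finZmodType) (f : {additive B -> A}) (g : {additive C -> A})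
    (s : seq (B * C)%type) :
    injective f -> injective g -> (forall b c, f b = g c -> f b = 0) ->
    #|A| = (#|B| * #|C|)%N -> doubly_Rstar s ->
  exists s' : seq A, doubly_Rstar s'.
Proof.
move=> f_inj g_inj fg cardA Rs; pose h (p : (B * C)%type) := f p.1 + g p.2.
have hB : {morph h : p q / p - q}.
  by move=> p q; rewrite /h !raddfB /=; zmodule.
pose h' : {additive (B * C)%type -> A} :=
  HB.pack h (GRing.isZmodMorphism.Build (B * C)%type A h hB).
exists (map h' s); apply: Rstar_additive_bij => //; last by rewrite card_prod.
apply/raddf_inj => -[b c] /eqP; rewrite -[_ == _]/(f b + g c == 0) addr_eq0 -raddfN.
move=> /eqP fbc; have fb0 := fg _ _ fbc.
have /f_inj -> : f b = f 0 by rewrite fb0 raddf0.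
have : g (- c) = g 0 by rewrite -fbc fb0 raddf0.
by move/g_inj/eqP; rewrite oppr_eq0 => /eqP ->.
Qed.

(** * Groups of order 4 and 8 *)

Lemma Z4_Rstar : doubly_Rstar ([:: 1; 3; 2; 3; 1; 2] : seq 'Z_4).
Proof.
split; last by exists 1, 2, [:: 3; 1; 2]; congr [:: _, _, _ & _]; apply: val_inj.
- by case=> -[|[|[|[|i]]]] // lti; vm_compute.
- by case=> -[|[|[|[|i]]]] // lti; vm_compute.
Qed.

Lemma Z8_Rstar : doubly_Rstar
  ([:: 1; 2; 1; 2; 4; 6; 3; 6; 3; 7; 5; 4; 7; 5] : seq 'Z_8).
Proof.
split; last first.
  by exists 1, 1, [:: 2; 4; 6; 3; 6; 3; 7; 5; 4; 7; 5]; congr [:: _, _, _ & _]; apply: val_inj.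
- by case=> -[|[|[|[|[|[|[|[|i]]]]]]]] // lti; vm_compute.
- by case=> -[|[|[|[|[|[|[|[|i]]]]]]]] // lti; vm_compute.
Qed.

Lemma Z4Z2_Rstar : doubly_Rstar
  ([:: (0, 1); (1, 1); (1, 0); (0, 1); (1, 0); (3, 0); (1, 1); (3, 0); (2, 0);
       (2, 1); (3, 1); (2, 0); (3, 1); (2, 1)] : seq ('Z_4 * 'Z_2)%type).
Proof.
split; last first.
  exists (0, 1), (1, 0), [:: (0, 1); (1, 0); (3, 0); (1, 1); (3, 0); (2, 0);
    (2, 1); (3, 1); (2, 0); (3, 1); (2, 1)]; congr [:: _, _, _ & _].
  by congr pair; apply: val_inj.
- by case=> -[[|[|[|[|i]]]]] // lti -[[|[|j]]] // ltj; vm_compute.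
- by case=> -[[|[|[|[|i]]]]] // lti -[[|[|j]]] // ltj; vm_compute.
Qed.

(** Doubling is two-to-one onto the even elements, and one of [y], [y + 1] is even. *)
Lemma Z4_square_count (y : 'Z_4) :
  (\sum_(m : 'Z_4) (m *+ 2 == y)%R + \sum_(m : 'Z_4) (m *+ 2 == y + 1)%R = 2)%N.
Proof.
rewrite !big_ord_recl !big_ord0.
by case: y => -[|[|[|[|i]]]] // lti; vm_compute.
Qed.

Lemma shift_invariant_const (N : finZmodType) (F : pred N) (g : N) :
    (forall m, F (m + g) = F m) -> (forall m, exists k, m = g *+ k) ->
  forall m, F m = F 0.
Proof.
move=> Fg gen m; have [k ->] := gen m.
by elim: k => [|k IHk]; rewrite ?mulr0n // mulrSr Fg.
Qed.

(** A generator [g] suffices by itself. If [g = 2], its two cosets are joined by [1 - 2], the first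
    minus the last term of the sequence for [Z_4]. *)
Lemma Z4_connected (g : 'Z_4) : g != 0 -> forall F : pred 'Z_4,
  (forall m, F (m + g) = F m) -> F (1 - 2) = F 0 -> forall m, F m = F 0.
Proof.
move=> g0 F Fg F3.
have [gE | gE] := eqVneq g 2; last first.
  (* Here [g] is 1 or 3, which is its own inverse modulo 4. *)
  apply: (shift_invariant_const Fg) => m; exists (val (g * m)).
  apply: val_inj; move: g0 gE {Fg F3} m.
  by case: g => -[|[|[|[|i]]]] // lti _ _ -[[|[|[|[|j]]]] // ltj]; vm_compute.
have F1 : F 1 = F 0.
  rewrite -F3 -(Fg 1) gE; congr (F _); exact: val_inj.
case=> -[|[|[|[|i]]]] // lti.
- by congr (F _); apply: val_inj.
- by rewrite -F1; congr (F _); apply: val_inj.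
- by rewrite -(Fg 0) gE; congr (F _); apply: val_inj.
- by rewrite -F1 -(Fg 1) gE; congr (F _); apply: val_inj.
Qed.

(** * Induction on the order *)

Section InductionSteps.
Variable A : finZmodType.
Hypothesis A_gt2 : (2 < #|A|)%N.
Hypothesis IH : forall Q : finZmodType, (#|Q| < #|A|)%N -> (2 < #|Q|)%N ->
  exists s : seq Q, doubly_Rstar s.

Lemma odd_prime_Rstar p : prime p -> odd p -> (p %| #|A|)%N ->
  exists s : seq A, doubly_Rstar s.
Proof.
move=> p_pr p_odd pA; have p_gt2 : (2 < p)%N := odd_prime_gt2 p_odd p_pr.
have F2 : (2 : 'F_p) != 0.
  by rewrite -(dvdn_pcharf (pchar_Fp p_pr)) gtnNdvd.
have [x _ xp] : {x : A | x \in [set: A] & #[x]%g = p} by apply: Cauchy; rewrite ?cardsT.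
(* ['F_p] unfolds to ['Z_(pdiv p)], so the embedding is built for the modulus [pdiv p]. *)
have xp' : #[x]%g = pdiv p by rewrite pdiv_id.
have pdiv_gt1 : (1 < pdiv p)%N by rewrite pdiv_id ?prime_gt1.
have [iota [iota_inj iota1 iotaP]] := exists_cyclic_embedding xp' pdiv_gt1.
have [sN RsN] : exists s : seq 'F_p, doubly_Rstar s by apply: field_Rstar; rewrite card_Fp.
have [Q [pi [pi_surj pi_ker]]] := exists_quotient <[x]>%G.
rewrite [#|_|]xp => cardA.
have Q_gt0 : (0 < #|Q|)%N by apply/card_gt0P; exists 0.
have [Q_gt2 | Q_le2] := ltnP 2 #|Q|.
  have [sQ RsQ] := IH (ltac:(rewrite -cardA; nia) : (#|Q| < #|A|)%N) Q_gt2.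
  case: sN RsN => [|n0 tl] RsN; first by case: RsN => _ _ [? [? [? //]]].
  apply: (@Rstar_extension _ A Q iota pi sQ n0 tl 0 1) => //.
  - by move=> u; rewrite pi_ker; apply: iotaP.
  - have half (y : 'F_p) : (\sum_(m : 'F_p) (m *+ 2 == y)%R = 1)%N.
      rewrite (bigD1 (y / 2)) //= -[y / 2 *+ 2]mulr_natr divfK // eqxx big1 // => m.
      by rewrite -[m *+ 2]mulr_natr -(inj_eq (mulIf F2)) divfK // => /negPf->.
    by move=> y; rewrite addr0 half.
  - move=> g g0 F Fg _; apply: (shift_invariant_const Fg) => m.
    exists (val (m / g : 'F_p)); rewrite -mulr_natr natr_Zp mulrC divfK //.
(* The quotient is too small for a circuit: [A] is [F_p] or [Z_2 * F_p]. *)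
have [Q1 | Q2] : #|Q| = 1%N \/ #|Q| = 2%N by lia.
  exists (map iota sN); apply: Rstar_additive_bij => //.
  by rewrite card_Fp // -cardA Q1 mul1n.
have [y _ y2] : {y : A | y \in [set: A] & #[y]%g = 2%N}.
  by apply: Cauchy; rewrite ?cardsT // -cardA Q2 dvdn_mulr.
have [iota2 [iota2_inj _ iota2P]] := exists_cyclic_embedding y2 isT.
have [s Rs] := Z2_field_Rstar F2.
apply: (Rstar_direct (f := iota2) (g := iota) _ _ _ _ Rs) => //.
  move=> b c bc; have : iota2 b \in (<[y]> :&: <[x]>)%g.
    rewrite inE; apply/andP; split; first by apply/iota2P; exists b.
    by rewrite bc; apply/iotaP; exists c.
  rewrite coprime_TIg; first by move/set1P.
  by rewrite -!orderE y2 xp coprime2n p_odd.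
by rewrite card_Fp // card_ord -cardA Q2.
Qed.

Lemma nonelementary_2group_Rstar (x : A) : (2.-nat #|A|)%N -> #[x]%g = 4%N ->
  exists s : seq A, doubly_Rstar s.
Proof.
move=> A2 x4; have [iota [iota_inj iota1 iotaP]] := exists_cyclic_embedding x4 isT.
have [Q [pi [pi_surj pi_ker]]] := exists_quotient <[x]>%G.
rewrite [#|_|]x4 => cardA.
have Q_gt0 : (0 < #|Q|)%N by apply/card_gt0P; exists 0.
have [Q_gt2 | Q_le2] := ltnP 2 #|Q|.
  have [sQ RsQ] := IH (ltac:(rewrite -cardA; nia) : (#|Q| < #|A|)%N) Q_gt2.
  apply: (@Rstar_extension _ A Q iota pi sQ 1 [:: 3; 2; 3; 1; 2] 1 1) => //.
  - by move=> u; rewrite pi_ker; apply: iotaP.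
  - exact: Z4_Rstar.
  - exact: Z4_square_count.
  - exact: Z4_connected.
have [Q1 | Q2] : #|Q| = 1%N \/ #|Q| = 2%N by lia.
  exists (map iota [:: 1; 3; 2; 3; 1; 2]); apply: Rstar_additive_bij Z4_Rstar => //.
  by rewrite card_ord -cardA Q1.
have [/existsP[z /eqP z8] | /existsPn no8] := boolP [exists z : A, #[z]%g == 8%N].
  have [iota8 [iota8_inj _ _]] := exists_cyclic_embedding z8 isT.
  eexists; apply: (Rstar_additive_bij iota8_inj _ Z8_Rstar).
  by rewrite card_ord -cardA Q2.
have [z zx] : exists z : A, z \notin <[x]>%g.
  apply/existsP; rewrite -negb_forall; apply/negP => /forallP xA.
  have : (#|A| <= #[x]%g)%N by apply/subset_leq_card/subsetP => u _; apply: xA.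
  by rewrite x4 -cardA Q2.
have z4 : z *+ 4 = 0.
  apply/eqP; rewrite -[_ == _]/((z ^+ 4 == 1)%g) -order_dvdn.
  have : #[z]%g \in divisors 8%N.
    by rewrite -dvdn_divisors // (_ : 8%N = #|[set: A]|) ?order_dvdG ?inE // cardsT -cardA Q2.
  by rewrite !inE => /or4P[] /eqP zo; have := no8 z; rewrite zo.
(* The double of [z] lies in [<[x]>] and is killed by 2, so it is 0 or [x *+ 2]; accordingly [z] or
   [z - x] is an involution outside [<[x]>]. *)
have [y y2 yx] : exists2 y : A, y *+ 2 = 0 & y \notin <[x]>%g.
  have /pi_ker/iotaP[m mE] : pi (z *+ 2) = 0.
    rewrite raddfMn; apply/eqP; rewrite -[_ == _]/((pi z ^+ 2 == 1)%g) -order_dvdn.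
    by rewrite -Q2 -cardsT order_dvdG ?inE.
  have /eqP m2 : m *+ 2 == 0.
    by rewrite -(inj_eq iota_inj) raddf0 raddfMn mE -mulrnA z4.
  have [m0 | m2'] : m = 0 \/ m = 2.
    by case: (m) m2 => -[|[|[|[|i]]]] // lti _; [left | right]; apply: val_inj.
    by exists z; rewrite // -mE m0 raddf0.
  exists (z - x).
    by rewrite mulrnBl -mE m2' -iota1 -raddfMn -raddfB subrr raddf0.
  apply: contra zx => /iotaP[j jE]; apply/iotaP; exists (j + 1).
  by rewrite raddfD jE iota1 subrK.
have y_ord : #[y]%g = 2%N.
  by apply: nt_prime_order => //; apply: contraNneq yx => ->; apply: group1.
have [iota2 [iota2_inj _ iota2P]] := exists_cyclic_embedding y_ord isT.
apply: (Rstar_direct iota_inj iota2_inj _ _ Z4Z2_Rstar) => //; last first.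
  by rewrite !card_ord -cardA Q2.
move=> b c bc; have : iota b \in (<[y]> :&: <[x]>)%g.
  rewrite inE andbC; apply/andP; split; first by apply/iotaP; exists b.
  by rewrite bc; apply/iota2P; exists c.
rewrite prime_TIg -?orderE ?y_ord ?cycle_subG //; first by move/set1P.
Qed.
End InductionSteps.

(** Such a group is isomorphic to the additive group of the field of the same order. *)
Lemma elementary_2group_Rstar (A : finZmodType) : (2 < #|A|)%N -> (2.-nat #|A|)%N ->
  (forall x : A, x *+ 2 = 0) -> exists s : seq A, doubly_Rstar s.
Proof.
move=> A_gt2 /p_natP[k cardA] A_exp2.
have k_gt0 : (0 < k)%N by case: k cardA A_gt2 => // ->.
have [F F2 cardF] := pPrimePowerField (isT : prime 2) k_gt0.
have abF : (2.-abelem [set: F])%g := fin_ring_pchar_abelem F2.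
have abA : (2.-abelem [set: A])%g.
  rewrite abelemE // FinRing.zmod_abelian; apply/exponentP => x _.
  exact: A_exp2.
have : [set: F] \isog [set: A].
  by rewrite (isog_abelem_card _ abF) abA !cardsT cardA cardF eqxx.
case/isogP=> f f_inj _.
have fD : {morph f : x y / x + y}.
  by move=> x y; rewrite -[x + y]/(x * y)%g morphM ?inE.
have f0 : f 0 = 0 by rewrite -[0]/(1%g : F) morph1.
pose h : {additive F -> A} := 
  HB.pack (f : F -> A) (GRing.isNmodMorphism.Build F A f (conj f0 fD)).
have [s Rs] : exists s : seq F, doubly_Rstar s.
  by apply: field_Rstar; rewrite cardF -cardA.
exists (map h s); apply: Rstar_additive_bij => //; last by rewrite cardA cardF.
by move=> x y /(injmP f_inj); apply; rewrite inE.
Qed.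

Theorem exists_Rstar (A : finZmodType) : (2 < #|A|)%N -> exists s : seq A, doubly_Rstar s.
Proof.
have [n] := ubnP #|A|; elim: n A => // n IHn A ltAn A_gt2.
have IH (Q : finZmodType) : (#|Q| < #|A|)%N -> (2 < #|Q|)%N ->
    exists s : seq Q, doubly_Rstar s.
  by move=> ltQA; apply: IHn; apply: leq_trans ltQA _.
have [A2 | ] := boolP (2.-nat #|A|)%N; last first.
  rewrite /pnat (ltn_trans _ A_gt2) //= => /allPn[p].
  rewrite mem_primes => /and3P[p_pr _ pA] p2.
  by apply: odd_prime_Rstar pA => //; case: (even_prime p_pr) p2 => // ->.
have [/forallP A_exp2 | ] := boolP [forall x : A, x *+ 2 == 0].
  by apply: elementary_2group_Rstar => // x; apply/eqP.
rewrite negb_forall => /existsP[x x2].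
have /p_natP[j xj] : (2.-nat #[x]%g)%N.
  by apply: pnat_dvd A2; rewrite -cardsT order_dvdG ?inE.
have j2 : (1 < j)%N.
  case: j xj => [|[|j]] // xj; case/eqP: x2; apply/eqP.
    by rewrite -[_ == _]/((x ^+ 2 == 1)%g) -order_dvdn xj.
  by rewrite -[_ == _]/((x ^+ 2 == 1)%g) -order_dvdn xj.
(* Since [x] has order [2 ^ j] with [j] at least 2, this multiple has order 4. *)
apply: (@nonelementary_2group_Rstar A A_gt2 IH (x *+ 2 ^ (j - 2))) => //.
rewrite -[#[_]%g]/(#[(x ^+ (2 ^ (j - 2)))%g]%g) orderXdiv xj ?dvdn_exp2l ?leq_subr //.
by rewrite -expnB ?subKn // leq_subr.
Qed.

(** * Return to multiplicative groups *)

Lemma Rstar_doubly_R_sequenceable (gT : finGroupType) (G : {group gT})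
    (abG : abelian [set: [subg G]]) (s : seq (additive_group abG)) :
  doubly_Rstar s -> doubly_R_sequenceable G.
Proof.
move=> [cs cd [a [b [r sE]]]]; pose f (x : additive_group abG) : gT := sgval x.
have exactly l : doubly_covers l -> map f l \in seqs_exactly 2 G^#%g.
  move=> cl; rewrite inE; apply/andP; split.
    apply/allP => _ /mapP[x xl ->]; rewrite !inE subgP andbT.
    have : (0 < count_mem x l)%N by rewrite -has_count has_pred1.
    rewrite cl; have [-> // | x0 _] := eqVneq x 0.
    by apply: contra_neq x0 => x1; apply: val_inj.
  apply/forall_inP => g; rewrite !inE => /andP[g1 Gg].
  have fE : f (subg G g) = g by rewrite /f subgK.
  rewrite -fE count_map (eq_count (a2 := pred1 (subg G g : additive_group abG))).
    rewrite cl; have [g0 | //] := eqVneq (subg G g : additive_group abG) 0.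
    by case/eqP: g1; rewrite -fE g0.
  by move=> x /=; rewrite (inj_eq val_inj).
have fB (x y : additive_group abG) : f (x - y) = ((f y)^-1 * f x)%g.
  by rewrite addrC.
exists (map f s); first exact: exactly.
suff -> : cyclic_quotients (map f s) = map f (differences (cyclic_arcs s)) by apply: exactly.
rewrite /cyclic_quotients /cyclic_arcs -[1%g in LHS]/(f 0) last_map.
elim: s (last 0 s) {cs cd sE} => //= x s IHs y; rewrite IHs.
by congr (_ :: _); rewrite -fB.
Qed.

Local Close Scope ring_scope.
Local Open Scope group_scope.

Theorem theorem2p3 (gT : finGroupType) (G : {group gT})
    (abG : abelian G) (G_neq_Z2 : ~~ (G \isog [set: 'Z_2])) :
  doubly_R_sequenceable G.
Proof.
have [G_gt2 | G_le2] := ltnP 2 #|G|.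
  have abG' : abelian [set: [subg G]] by rewrite -(isog_abelian (isog_subg G)).
  have [|s] := @exists_Rstar (additive_group abG'); last exact: Rstar_doubly_R_sequenceable.
  by rewrite -cardsT -(card_isog (isog_subg G)).
(* The empty sequence serves the trivial group; a group of order 2 is the excluded one. *)
have [G1 | G2] : #|G| = 1%N \/ #|G| = 2 by have := cardG_gt0 G; lia.
  exists [::]; rewrite !inE /=; apply/forall_inP => x;
    by rewrite (card1_trivg G1) setDv inE.
case/negP: G_neq_Z2; rewrite isog_cyclic_card; last by rewrite prime_cyclic ?G2.
by rewrite G2 cardsT card_ord prime_cyclic // cardsT card_ord.
Qed.
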